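(* Let $R$ be a commutative integral domain such that every singular $2\times 2$ matrix with entries in $R$ is a product of idempotent matrices (with entries in $R$). Then $R$ is a Prüfer domain.
   Context: A matrix over an integral domain is singular if its determinant is $0$. A square matrix $E$ is idempotent if $E^2=E$. A Prüfer domain is an integral domain in which every nonzero finitely generated ideal is invertible. *)

(* Defs.v *)
From mathcomp Require Import all_boot all_order all_algebra.
From mathcomp Require Import classical_sets.

Set Implicit Arguments.
Unset Strict Implicit.
Unset Printing Implicit Defensive.

Import GRing.Theory.
Local Open Scope classical_set_scope.
Local Open Scope ring_scope.

Definition idempotent_mx (R : pzSemiRingType) n (E : 'M[R]_n) : Prop :=
  E *m E = E.

Definition singular_mx (R : comPzRingType) n (A : 'M[R]_n) : Prop :=
  \det A = 0.

Definition product_of_idempotents (R : pzSemiRingType) n (A : 'M[R]_n) : Prop :=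
  exists s : seq 'M[R]_n,
    (forall E, E \in s -> idempotent_mx E) /\ A = \prod_(E <- s) E.

Section Prufer.

Variable R : idomainType.

(* Ideals are Prop-valued and may be the whole ring, unlike the (boolean,
   proper) ideals of mathcomp's ring_quotient. *)
Definition is_ideal (I : set R) : Prop :=
  [/\ I 0, forall x y, I x -> I y -> I (x + y) & forall r x, I x -> I (r * x)].

Definition finitely_generated (I : set R) : Prop :=
  exists n (a : 'I_n -> R),
    I = [set x | exists c : 'I_n -> R, x = \sum_(i < n) c i * a i].

Definition is_fractional_ideal (J : set {fraction R}) : Prop :=
  [/\ J 0,
      forall x y, J x -> J y -> J (x + y),
      forall (r : R) x, J x -> J (tofrac r * x)
    & exists2 d : R, d != 0 &
        forall x, J x -> exists r : R, tofrac d * x = tofrac r].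

Definition fractional_mul (I J : set {fraction R}) : set {fraction R} :=
  [set x | exists s : seq ({fraction R} * {fraction R}),
     (forall p, p \in s -> I p.1 /\ J p.2) /\ x = \sum_(p <- s) p.1 * p.2].

Definition invertible_ideal (I : set R) : Prop :=
  exists J : set {fraction R},
    is_fractional_ideal J /\
    fractional_mul ((@tofrac R) @` I) J = range (@tofrac R).

Definition prufer_domain : Prop :=
  forall I : set R,
    is_ideal I -> finitely_generated I -> I <> [set 0] -> invertible_ideal I.

End Prufer.

(* Main.v *)
(* Writing a singular matrix with first row (a, b) as a product of idempotents,
   its last non-identity factor E is singular and fixes (a, b).  The entries of
   E provide x with x b in (a) and (1 - x) a in (b).  By induction, every
   finite family a_i admits a partition of unity sum_i e_i = 1 such that
   e_i a_j lies in (a_i) for all j; the fractions e_i / a_i then witness that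
   the ideal generated by the a_i is invertible. *)
Require Import Defs.
From mathcomp Require Import all_boot all_order all_algebra.
From mathcomp Require Import classical_sets ring.

Set Implicit Arguments.
Unset Strict Implicit.
Unset Printing Implicit Defensive.

Import GRing.Theory.
Local Open Scope classical_set_scope.
Local Open Scope ring_scope.

(** Multiplying [E *m E = E] by the adjugate gives [\det E * E = \det E * 1] entrywise, and a
    nonzero determinant cancels in a domain. *)
Lemma idempotent_mx_eq1 (R : idomainType) n (E : 'M[R]_n) :
  idempotent_mx E -> \det E != 0 -> E = 1%:M.
Proof.
move=> EE dE; have : \adj E *m (E *m E) = \adj E *m E by rewrite EE.
rewrite mulmxA mul_adj_mx mul_scalar_mx => /matrixP dEE.
apply/matrixP=> i j; apply: (mulfI dE); have := dEE i j.
by rewrite !mxE mulr_natr.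
Qed.

(** Factors are peeled off from the right. A singular last factor fixes [A] by idempotency; a
    nonsingular one is the identity and is dropped. The empty product is excluded, having
    determinant 1. *)
Lemma singular_product_fixed (R : idomainType) n (A : 'M[R]_n) :
  singular_mx A -> product_of_idempotents A ->
  exists2 E : 'M[R]_n, singular_mx E & A *m E = A.
Proof.
move=> + [s [+ As]]; elim/last_ind: s A As => [|s E IHs] A -> dA sE.
  by move: dA; rewrite /singular_mx big_nil det1 => /eqP; rewrite oner_eq0.
have EE : idempotent_mx E by apply: sE; rewrite mem_rcons mem_head.
have sP F : F \in s -> idempotent_mx F.
  by move=> Fs; apply: sE; rewrite mem_rcons inE Fs orbT.
have PE : \prod_(F <- rcons s E) F = \prod_(F <- s) F *m E by rewrite big_rcons.
rewrite PE in dA *; have [dE|dE] := eqVneq (\det E) 0.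
  by exists E => //; rewrite -mulmxA EE.
by rewrite (idempotent_mx_eq1 EE dE) mulmx1 in dA *; exact: IHs.
Qed.

Lemma singular_fixed_row (R : comPzRingType) (a b p q r s : R) :
  p * s = q * r -> a * p + b * r = a -> a * q + b * s = b ->
  a * q = b * p /\ a * (1 - p) = b * r.
Proof.
move=> det0 fixa fixb; split; last by rewrite mulrBr mulr1 -{1}fixa addrC addKr.
(* Substituting both fixed-row equations leaves the terms [b * (q * r)] and [b * (p * s)] to
   compare, equal by [det0]. *)
rewrite -{1}fixa -{2}fixb mulrDl [RHS]mulrDl -[b * r * q]mulrA [r * q]mulrC.
by rewrite -det0; ring.
Qed.

Lemma det_mx22 (R : comPzRingType) (A : 'M[R]_2) :
  \det A = A 0 0 * A 1 1 - A 0 1 * A 1 0.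
Proof.
have lift1 : lift 0 0 = 1 :> 'I_2 by apply: val_inj.
have lift0 : lift 1 0 = 0 :> 'I_2 by apply: val_inj.
rewrite (expand_det_row _ 0) !big_ord_recl big_ord0 addr0 /cofactor !det_mx11.
by rewrite !mxE lift1 lift0 /= mul1r expr1 mulN1r mulrN.
Qed.

Lemma singular_product_split (R : idomainType) :
  (forall A : 'M[R]_2, singular_mx A -> product_of_idempotents A) ->
  forall a b : R, exists x y z : R, a * y = b * x /\ a * (1 - x) = b * z.
Proof.
move=> IP a b; pose A : 'M[R]_2 :=
  \matrix_(i, j) if i == 0 then if j == 0 then a else b else 0.
have dA : singular_mx A by rewrite /singular_mx det_mx22 !mxE /= !mulr0 subr0.
have [E dE /matrixP AE] := singular_product_fixed dA (IP A dA).
have := AE 0 0; have := AE 0 1; rewrite !mxE !big_ord_recl !big_ord0 !mxE /=.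
rewrite !addr0 => fixb fixa; exists (E 0 0), (E 0 1), (E 1 0).
have lift1 : lift ord0 ord0 = 1 :> 'I_2 by apply: val_inj.
rewrite lift1 in fixa fixb; apply: (singular_fixed_row _ fixa fixb).
by apply/eqP; rewrite -subr_eq0 -det_mx22; apply/eqP.
Qed.

(** Given a partition [e] for the tail of the family, split each tail generator against [a ord0]:
    the share [e k * x k] stays at its index, and all shares [e k * (1 - x k)] move to index 0. *)
Lemma split_partition_of_unity (R : comPzRingType) :
  (forall a b : R, exists x y z : R, a * y = b * x /\ a * (1 - x) = b * z) ->
  forall n (a : 'I_n.+1 -> R), exists e : 'I_n.+1 -> R,
    \sum_i e i = 1 /\ forall i j, exists c, e i * a j = c * a i.
Proof.
move=> splitR; elim=> [|n IHn] a.
  exists (fun=> 1); split=> [|i j]; first by rewrite big_ord1.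
  by exists 1; rewrite !ord1.
have [e [sum_e ea]] := IHn (a \o lift ord0).
have /fin_all_exists[x xP] : forall i, exists x, exists y z,
    a (lift ord0 i) * y = a ord0 * x /\ a (lift ord0 i) * (1 - x) = a ord0 * z.
  by move=> i; apply: splitR.
exists (fun i => if unlift ord0 i is Some k then e k * x k
                 else \sum_k e k * (1 - x k)).
split=> [|i j].
  rewrite big_ord_recl unlift_none; under [X in _ + X]eq_bigr do rewrite liftK.
  rewrite -big_split -[RHS]sum_e; apply: eq_bigr => k _ /=.
  by rewrite -mulrDr subrK mulr1.
case: (unliftP ord0 i) => [k|] ->; case: (unliftP ord0 j) => [l|] ->.
- by have [c /= kl] := ea k l; exists (c * x k); rewrite mulrAC kl mulrAC.
- have [y [z [xy _]]] := xP k; exists (e k * y).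
  by rewrite -mulrA [x k * _]mulrC -xy mulrCA [RHS]mulrC.
(* Two moves: [e k] carries the [l]-th tail generator into the ideal of the [k]-th, then [1 - x k]
   carries that into the ideal of [a ord0]. *)
- have /fin_all_exists[c ca] : forall k, exists c,
      e k * (1 - x k) * a (lift ord0 l) = c * a ord0.
    move=> k; have [c /= kl] := ea k l; have [y [z [_ xz]]] := xP k.
    by exists (c * z); rewrite mulrAC kl -[LHS]mulrA xz -mulrA [z * _]mulrC.
  by exists (\sum_k c k); rewrite !mulr_suml; apply: eq_bigr.
- by exists (\sum_k e k * (1 - x k)).
Qed.

Lemma partition_of_unity_invertible (R : idomainType) n (a e : 'I_n -> R) k :
  a k != 0 -> \sum_i e i = 1 ->
  (forall i j, exists c, e i * a j = c * a i) ->
  invertible_ideal [set x | exists c : 'I_n -> R, x = \sum_(i < n) c i * a i].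
Proof.
move=> ak0 sum_e ea; set I := [set x | _].
have Ia i : I (a i).
  exists (fun j => (j == i)%:R); rewrite (bigD1 i) //= eqxx mul1r.
  by rewrite big1 ?addr0 // => j /negPf->; rewrite mul0r.
(* The inverse is taken to be the largest candidate, the colon [(R : I)] in the fraction field. *)
pose J := [set x | forall y, I y -> range (@tofrac R) (x * tofrac y)].
exists J; split.
  split=> [y _|x y Jx Jy z Iz|r x Jx y Iy|].
  - by exists 0 => //; rewrite mul0r rmorph0.
  - have [u _ xu] := Jx z Iz; have [v _ yv] := Jy z Iz.
    by exists (u + v) => //; rewrite mulrDl -xu -yv rmorphD.
  - by have [u _ xu] := Jx y Iy; exists (r * u) => //; rewrite -mulrA -xu rmorphM.
  (* Any nonzero element of [I] is a common denominator for [J]. *)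
  - by exists (a k) => // x /(_ _ (Ia k))[r _ xr]; exists r; rewrite mulrC xr.
apply/seteqP; split=> [_ [s [sIJ ->]]|_ [r _ <-]].
  rewrite big_seq; apply: big_ind => [|x y [u _ <-] [v _ <-]|p /sIJ].
  - by exists 0 => //; rewrite rmorph0.
  - by exists (u + v) => //; rewrite rmorphD.
  - by case=> -[y Iy <-] /(_ _ Iy); rewrite mulrC.
(* Indices with [a i = 0] are harmless: there [e i / a i] is 0 and nothing is lost from the sum of
   the [e i]. *)
have e0 i : a i = 0 -> e i = 0.
  move=> ai0; have [c /eqP] := ea i k.
  by rewrite ai0 mulr0 mulf_eq0 (negPf ak0) orbF => /eqP.
exists [seq (tofrac (r * a i), tofrac (e i) / tofrac (a i)) | i <- enum 'I_n].
split=> [_ /mapP[i _ ->]|]; last first.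
  rewrite big_map big_enum /= -[r in LHS]mulr1 -sum_e mulr_sumr rmorph_sum.
  apply: eq_bigr => i _ /=; rewrite !rmorphM /=.
  have [/[dup] ai0 /e0 ->|ai0] := eqVneq (a i) 0.
    by rewrite !rmorph0 !mulr0 mul0r mulr0.
  by rewrite -[RHS]mulrA [_ * (_ / _)]mulrC divfK ?tofrac_eq0.
split=> /=.
  exists (r * a i) => //; have [c ai] := Ia i.
  by exists (fun j => r * c j); rewrite ai mulr_sumr; under eq_bigr do rewrite mulrA.
(* It remains that [e i / a i] lies in [J], checked on each term [c j * a j]. *)
move=> _ [c ->]; rewrite rmorph_sum mulr_sumr.
apply: big_ind => [|x y [u _ <-] [v _ <-]|j _].
- by exists 0 => //; rewrite rmorph0.
- by exists (u + v) => //; rewrite rmorphD.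
have [ai0|ai0] := eqVneq (a i) 0.
  by exists 0 => //; rewrite (e0 i ai0) !rmorph0 !mul0r.
have [d eij] := ea i j; exists (c j * d) => //.
rewrite !rmorphM /= mulrCA; congr (_ * _).
by rewrite mulrAC -rmorphM eij rmorphM mulfK ?tofrac_eq0.
Qed.

Theorem theorem2p2 (R : idomainType) :
  (forall A : 'M[R]_2, singular_mx A -> product_of_idempotents A) ->
  prufer_domain R.
Proof.
move=> IP I _ [n [a ->]] I0.
have [[k ak0]|a0] : (exists k, a k != 0) \/ forall k, a k = 0.
  have [/existsP|] := boolP [exists k, a k != 0]; first by left.
  by rewrite negb_exists => /forallP a0; right=> k; apply/eqP; rewrite -[_ == _]negbK.
  (* The index [k] rules out an empty family of generators. *)
  case: n a k ak0 I0 => [|n] a k ak0 _; first by case: k ak0.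
  have [e [sum_e ea]] := split_partition_of_unity (singular_product_split IP) a.
  exact: partition_of_unity_invertible ak0 sum_e ea.
case: I0; apply/seteqP; split=> [_ [c ->]|_ ->] /=.
  by rewrite big1 // => i _; rewrite a0 mulr0.
by exists (fun=> 0); rewrite big1 // => i _; rewrite mul0r.
Qed.
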